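(* Let $G$ be a finite group. Then $\mathcal{P}(G) = \mathcal{S}(G)$ (i.e. these two graphs on the vertex set $G$ have the same edges) if and only if $G$ is cyclic.
   Context: All graphs are simple and undirected. The power graph $\mathcal{P}(G)$ of a finite group $G$ has vertex set $G$, and two distinct elements are adjacent if and only if one is a power of the other. The order supergraph $\mathcal{S}(G)$ has vertex set $G$, and two distinct elements $x,y$ are adjacent if and only if $o(x)\mid o(y)$ or $o(y)\mid o(x)$, where $o(x)$ denotes the order of $x$. *)

(* Defs.v *)
From mathcomp Require Import all_boot all_fingroup all_solvable.

Set Implicit Arguments.
Unset Strict Implicit.
Unset Printing Implicit Defensive.

Local Open Scope group_scope.

(* A graph with vertex set G is given by its adjacency relation on the ambient
   type gT; membership of both endpoints in G is part of adjacency. *)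

(* In a finite group every integer power is a power with exponent in nat. *)
Definition is_power (gT : finGroupType) (x y : gT) : Prop :=
  exists n : nat, x = y ^+ n.

Definition power_graph (gT : finGroupType) (G : {group gT}) (x y : gT) : Prop :=
  [/\ x \in G, y \in G, x <> y & is_power x y \/ is_power y x].

Definition order_supergraph (gT : finGroupType) (G : {group gT}) (x y : gT) :
    Prop :=
  [/\ x \in G, y \in G, x <> y & #[x] %| #[y] \/ #[y] %| #[x]].

Lemma power_graph_sym (gT : finGroupType) (G : {group gT}) (x y : gT) :
  power_graph G x y -> power_graph G y x.
Proof. by case=> Gx Gy neq [] H; split=> //; auto. Qed.

Lemma power_graph_irr (gT : finGroupType) (G : {group gT}) (x : gT) :
  ~ power_graph G x x.
Proof. by case. Qed.

Lemma order_supergraph_sym (gT : finGroupType) (G : {group gT}) (x y : gT) :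
  order_supergraph G x y -> order_supergraph G y x.
Proof. by case=> Gx Gy neq [] H; split=> //; auto. Qed.

Lemma order_supergraph_irr (gT : finGroupType) (G : {group gT}) (x : gT) :
  ~ order_supergraph G x x.
Proof. by case. Qed.

(* Main.v *)
Require Import Defs.
From mathcomp Require Import all_boot all_fingroup all_solvable.

(** Being a power always forces divisibility of orders, so only the converse
    matters. In a cyclic group a subgroup is determined by its order and one
    subgroup contains another as soon as the orders divide ([cardSg_cyclic]);
    applied to cyclic subgroups, this turns divisibility of orders back into
    being a power. Conversely, two distinct elements of equal order are always
    adjacent in the order supergraph; if they are also adjacent in the power
    graph, they generate the same subgroup. Hence G has at most one cyclic
    subgroup of each order, so at most phi(d) elements of order d for each d
    dividing #|G|. As the phi(d) sum to #|G|, all these bounds are attained,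
    and some element has order #|G|; this counting is [order_inj_cyclic]. *)

Lemma is_power_cycleP (gT : finGroupType) (x y : gT) :
  is_power x y <-> (x \in <[y]>)%g.
Proof. by split=> [[n ->] | /cycleP[n ->]]; [apply: mem_cycle | exists n]. Qed.

Lemma is_power_order_dvd (gT : finGroupType) (x y : gT) :
  is_power x y -> #[x]%g %| #[y]%g.
Proof. by case=> n ->; apply: orderXdvd. Qed.

Lemma cyclic_is_powerE (gT : finGroupType) (G : {group gT}) (x y : gT) :
  cyclic G -> x \in G -> y \in G -> is_power x y <-> #[x]%g %| #[y]%g.
Proof.
move=> cycG Gx Gy; split; first exact: is_power_order_dvd.
move=> dvd_xy; apply/is_power_cycleP.
by rewrite -cycle_subG -(cardSg_cyclic cycG) ?cycle_subG.
Qed.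

Lemma is_power_order_eq (gT : finGroupType) (x y : gT) :
  is_power x y -> #[x]%g = #[y]%g -> <[x]>%g = <[y]>%g.
Proof.
move=> /is_power_cycleP y_x eq_o; apply/eqP.
by rewrite eqEcard cycle_subG y_x -!orderE eq_o leqnn.
Qed.

Theorem theorem2p2 (gT : finGroupType) (G : {group gT}) :
  (forall x y : gT, power_graph G x y <-> order_supergraph G x y) <-> cyclic G.
Proof.
split=> [eqPS | cycG x y].
  apply: order_inj_cyclic => x y Gx Gy eq_o.
  have [-> // | /eqP neq_xy] := eqVneq x y.
  have /eqPS[_ _ _ [x_y | y_x]]: order_supergraph G x y.
  - by split=> //; left; rewrite eq_o.
  - exact: is_power_order_eq.
  - exact/esym/is_power_order_eq.
split=> [] [Gx Gy neq_xy adj]; split=> //.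
  by case: adj => /is_power_order_dvd; [left | right].
by case: adj => dvd_o; [left | right]; apply/(cyclic_is_powerE _ _ _ _ cycG).
Qed.
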